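(* Let $f:[0,\infty)\to[0,\infty)$ be $2$-radical convex. Then, for $0\le t\le 1$, $$f(t)\le f(1)\,t-f\left(\sqrt{t(1-t)}\right)\le f(1)\,t.$$
   Context: Let $p\ge 1$. A continuous function $f:[0,\infty)\to[0,\infty)$ with $f(0)=0$ is called $p$-radical convex if the function $x\mapsto f\left(x^{1/p}\right)$ is convex on $[0,\infty)$. In particular $f$ is $2$-radical convex if $x\mapsto f(\sqrt{x})$ is convex on $[0,\infty)$. *)

(* Defs.v *)
(* MathComp-Analysis, over an arbitrary R : realType. *)
From mathcomp Require Import all_boot all_order all_algebra.
From mathcomp Require Import all_classical all_reals all_analysis.

Set Implicit Arguments.
Unset Strict Implicit.
Unset Printing Implicit Defensive.

Import Order.TTheory GRing.Theory Num.Theory.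
Import numFieldNormedType.Exports.

Local Open Scope classical_set_scope.
Local Open Scope ring_scope.

(* A function [0, oo) -> [0, oo) is a total f : R -> R of which only the values
   on `[0, +oo[ are constrained.  As p != 0, the library's x `^ p^-1 is 0 at
   x = 0, so it is the usual p-th root on all of `[0, +oo[. *)
Definition radical_convex (R : realType) (p : R) (f : R -> R) : Prop :=
  [/\ 1 <= p,
      set_fun `[0, +oo[ `[0, +oo[ f,
      {within `[0, +oo[, continuous f},
      f 0 = 0 &
      convex_function (E := R^o) `[0, +oo[ (fun x : R => f (x `^ p^-1))].

(* Main.v *)
(* The convex function g x = f (sqrt x) vanishes at 0, hence g x <= x g 1 on
   [0, 1].  Add this inequality at x = t^2 and at x = t (1 - t): since
   t^2 + t (1 - t) = t, the sum is the first claimed inequality. *)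
Require Import Defs.
From mathcomp Require Import all_boot all_order all_algebra.
From mathcomp Require Import all_classical all_reals all_analysis.

Import Order.TTheory GRing.Theory Num.Theory.

Local Open Scope classical_set_scope.
Local Open Scope ring_scope.

(** Convexity along the chord over [0, 1]: [x] is the mean of 1 and 0 with weights [x] and [1 - x],
    and the end at 0 contributes [f 0 = 0]. *)
Lemma radical_convex_le (R : realType) (p : R) (f : R -> R) (x : R) :
  radical_convex p f -> 0 <= x -> x <= 1 -> f (x `^ p^-1) <= x * f 1.
Proof.
move=> [p1 _ _ f0 fconv] x0 x1.
have pV0 : p^-1 != 0 by rewrite invr_eq0 gt_eqF // (lt_le_trans ltr01).
have m1 : (1 : R) \in [set` `[(0 : R), +oo[] by rewrite inE /= in_itv /= ler01.
have m0 : (0 : R) \in [set` `[(0 : R), +oo[] by rewrite inE /= in_itv /= lexx.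
have : f ((x * 1 + (1 - x) * 0) `^ p^-1)
    <= x * f (1 `^ p^-1) + (1 - x) * f (0 `^ p^-1).
  exact: (fconv (Itv01 x0 x1) _ _ m1 m0).
by rewrite mulr0 mulr1 addr0 powR1 powR0 // f0 mulr0 addr0.
Qed.

Theorem corollary2p2 (R : realType) (f : R -> R) (hf : radical_convex 2 f)
    (t : R) (ht0 : 0 <= t) (ht1 : t <= 1) :
  f t <= f 1 * t - f (Num.sqrt (t * (1 - t))) /\
  f 1 * t - f (Num.sqrt (t * (1 - t))) <= f 1 * t.
Proof.
have t'0 : 0 <= 1 - t by rewrite subr_ge0.
have f_sqrt_le x : 0 <= x -> x <= 1 -> f (Num.sqrt x) <= x * f 1.
  by move=> x0 x1; rewrite -powR12_sqrt //; exact: radical_convex_le.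
split; last first.
  (* The second inequality is just [f >= 0] at the square root. *)
  rewrite gerBl; have [_ fge0 _ _ _] := hf.
  have := fge0 (Num.sqrt (t * (1 - t))).
  by rewrite /= !in_itv /= !andbT; apply; exact: sqrtr_ge0.
have -> : f 1 * t = (t ^+ 2 + t * (1 - t)) * f 1.
  by rewrite mulrBr mulr1 expr2 addrC subrK mulrC.
rewrite lerBrDr mulrDl lerD //.
  (* As [t >= 0], [t] is the square root of [t ^+ 2], which puts [f t] in the form bounded by
     [f_sqrt_le]. *)
  rewrite -[X in f X <= _](ger0_norm ht0) -sqrtr_sqr.
  by apply: f_sqrt_le; rewrite ?sqr_ge0 ?expr_le1.
apply: f_sqrt_le; first exact: mulr_ge0.
by rewrite mulr_ile1 // gerBl.
Qed.
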